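(* Let $\mu$ be a purely atomic measure on $(E,\mathcal E)$ where all the atoms are singletons. (a) $(\widetilde{\mathcal E},d_\mu)$ is separable if and only if $\sum_{x\in E_{fin}}\mu(\{x\})<\infty$ and $E_\infty$ is finite. (b) $(\widetilde{\mathcal E}_{fin},d_\mu)$ is separable if and only if $E_{fin}$ is countable.
   Context: A set $A\in\mathcal E$ is an atom of $\mu$ if $0<\mu(A)<\infty$ and for every $C\subset A$ with $C\in\mathcal E$, either $\mu(C)=0$ or $\mu(C)=\mu(A)$. The measure $\mu$ is purely atomic if there is a collection $\mathcal C$ of atoms of $\mu$ such that for each $A\in\mathcal E$, $\mu(A)$ is the sum of the numbers $\mu(C)$ over all $C\in\mathcal C$ such that $\mu(A\cap C)=\mu(C)$. Define $E_{fin}=\{x\in E:0<\mu(\{x\})<\infty\}$ (the set of all atoms with finite measure) and $E_\infty=\{x\in E:\mu(\{x\})=\infty\}$ (the set of all atoms with infinite measure). For $A\in\mathcal E$ let $[A]=\{B\in\mathcal E:\mu(A\Delta B)=0\}$, where $\Delta$ is symmetric difference, $\widetilde{\mathcal E}=\{[A]:A\in\mathcal E\}$ and $\widetilde{\mathcal E}_{fin}=\{[A]:A\in\mathcal E,\ \mu(A)<\infty\}$, with the metric (possibly taking the value $\infty$ on $\widetilde{\mathcal E}$) $d_\mu([A],[B])=\mu(A\Delta B)^{1/2}$ and the topology it generates. ''Countable'' includes finite. *)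

(* Defs.v *)
From HB Require Import structures.
From mathcomp Require Import all_boot all_order all_algebra.
From mathcomp Require Import all_classical all_reals all_analysis.

Set Implicit Arguments.
Unset Strict Implicit.
Unset Printing Implicit Defensive.

Import Order.TTheory GRing.Theory Num.Theory.
Import numFieldNormedType.Exports.

Local Open Scope classical_set_scope.
Local Open Scope ring_scope.
Local Open Scope ereal_scope.

Section Atoms.
Context (d : measure_display) (E : measurableType d) (R : realType).
Variable mu : {measure set E -> \bar R}.

Definition is_atom (A : set E) : Prop :=
  [/\ measurable A, 0 < mu A < +oo &
      forall C : set E, measurable C -> C `<=` A -> mu C = 0 \/ mu C = mu A].

(* The sigma-algebra need not contain every singleton, and a library measure
   takes arbitrary values off the sigma-algebra; hence the measurability
   clauses. *)
Definition E_fin : set E :=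
  [set x | measurable [set x] /\ 0 < mu [set x] < +oo].

Definition E_infty : set E :=
  [set x | measurable [set x] /\ mu [set x] = +oo].

(* [is_atom] only allows finite mass, while the points of [E_infty] are
   regarded as atoms of infinite mass.  The collection may contain both kinds:
   with finite atoms alone, [E_infty] would always be empty. *)
Definition purely_atomic_with (CC : set (set E)) : Prop :=
  CC `<=` is_atom `|` [set [set x] | x in E_infty] /\
  forall A : set E, measurable A ->
    mu A = \esum_(C in CC `&` [set C | mu (A `&` C) = mu C]) mu C.

Definition mclass (A : set E) : set (set E) :=
  [set B | measurable B /\ mu (A `+` B) = 0].

Definition mclasses (P : set (set E)) : set (set (set E)) :=
  [set mclass A | A in measurable `&` P].

(* Evaluated on chosen representatives; independent of the choice by
   [dmuE]. *)
Definition dmu (X Y : set (set E)) : \bar R :=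
  sqrte (mu (xget set0 X `+` xget set0 Y)).

Lemma measurable_setY (A B : set E) :
  measurable A -> measurable B -> measurable (A `+` B).
Proof. by move=> mA mB; apply: measurableU; apply: measurableD. Qed.

Lemma measure_setY_triangle (A B C : set E) :
  measurable A -> measurable B -> measurable C ->
  mu (A `+` C) <= mu (A `+` B) + mu (B `+` C).
Proof.
move=> mA mB mC.
have mAB := measurable_setY mA mB; have mBC := measurable_setY mB mC.
apply: (@le_trans _ _ (mu ((A `+` B) `|` (B `+` C)))); last exact: measureU2.
apply: le_measure; rewrite ?inE.
- exact: measurable_setY.
- exact: measurableU.
- by move=> x /=; have [|] := pselect (B x); tauto.
Qed.

Lemma mclass_refl (A : set E) : measurable A -> mclass A A.
Proof. by move=> mA; split => //; rewrite setYK measure0. Qed.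

Lemma mclass_xget (A : set E) : measurable A ->
  mclass A (xget set0 (mclass A)).
Proof. by move=> mA; apply: xgetPex; exists A; exact: mclass_refl. Qed.

Lemma dmuE (A B : set E) : measurable A -> measurable B ->
  dmu (mclass A) (mclass B) = sqrte (mu (A `+` B)).
Proof.
move=> mA mB; rewrite /dmu.
have [] := mclass_xget mA; have [] := mclass_xget mB.
set B' := xget _ (mclass B); set A' := xget _ (mclass A) => mB' B0 mA' A0.
congr sqrte; apply/eqP; rewrite eq_le; apply/andP; split.
- apply: (le_trans (measure_setY_triangle mA' mA mB')).
  rewrite setYC A0 add0e (le_trans (measure_setY_triangle mA mB mB'))//.
  by rewrite B0 adde0.
- apply: (le_trans (measure_setY_triangle mA mA' mB)).
  rewrite A0 add0e (le_trans (measure_setY_triangle mA' mB' mB))//.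
  by rewrite (setYC B' B) B0 adde0.
Qed.

Lemma sqrte_subadd (x y : \bar R) : 0 <= x -> 0 <= y ->
  sqrte (x + y) <= sqrte x + sqrte y.
Proof.
move: x y => [x| |] [y| |]//=; rewrite !lee_fin => x0 y0.
rewrite -ler_sqr ?nnegrE ?addr_ge0 ?sqrtr_ge0//.
by rewrite sqrrD !sqr_sqrtr ?addr_ge0// lerD2r lerDl mulrn_wge0//.
Qed.

Lemma dmu_triangle (P : set (set E)) (X Y Z : set (set E)) :
  mclasses P X -> mclasses P Y -> mclasses P Z ->
  dmu X Z <= dmu X Y + dmu Y Z.
Proof.
move=> [A [mA _] <-] [B [mB _] <-] [C [mC _] <-]; rewrite !dmuE//.
apply: le_trans (sqrte_subadd _ _); rewrite ?measure_ge0//.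
by rewrite lee_sqrt ?adde_ge0 ?measure_ge0// measure_setY_triangle.
Qed.

Definition mclass_space (P : set (set E)) : Type := set_type (mclasses P).

HB.instance Definition _ (P : set (set E)) :=
  Choice.copy (mclass_space P) (set_type (mclasses P)).

Section Topology.
Variable P : set (set E).

Definition mclass_ball (X : mclass_space P) (e : R) : set (mclass_space P) :=
  [set Y | dmu (val X) (val Y) < e%:E].

Let ent : set_system (mclass_space P * mclass_space P) :=
  entourage_ mclass_ball.

Let nbhs (X : mclass_space P) : set_system (mclass_space P) := nbhs_ ent X.

Let nbhsE : nbhs = nbhs_ ent. Proof. by []. Qed.

Let ball_center X (e : R) : (0 < e)%R -> mclass_ball X e X.
Proof.
by move=> e0; rewrite /mclass_ball/= /dmu setYK measure0 sqrte0 lte_fin.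
Qed.

Let ball_sym X Y (e : R) : mclass_ball X e Y -> mclass_ball Y e X.
Proof. by rewrite /mclass_ball/= /dmu setYC. Qed.

Let ball_triangle X Y Z (e1 e2 : R) :
  mclass_ball X e1 Y -> mclass_ball Y e2 Z -> mclass_ball X (e1 + e2)%R Z.
Proof.
rewrite /mclass_ball/= => XY YZ; rewrite EFinD.
apply: (le_lt_trans (@dmu_triangle P _ (val Y) _ _ _ _)).
- exact: set_mem (valP X).
- exact: set_mem (valP Y).
- exact: set_mem (valP Z).
- exact: lteD.
Qed.

Let entE : ent = entourage_ mclass_ball. Proof. by []. Qed.

HB.instance Definition _ := hasNbhs.Build (mclass_space P) nbhs.

HB.instance Definition _ := @Nbhs_isPseudoMetric.Build R (mclass_space P)
  ent nbhsE mclass_ball ball_center ball_sym ball_triangle entE.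

End Topology.

Definition tildeE : pseudoMetricType R := mclass_space setT.

Definition tildeE_fin : pseudoMetricType R :=
  mclass_space [set A | mu A < +oo].

End Atoms.

Definition separable (T : topologicalType) : Prop :=
  exists D : set T, countable D /\ dense D.

(* Main.v *)
(* Off the null part, a measurable set [A] is approximated from inside by finite
   sets of point atoms, so the finite subsets of a countable set of atoms are
   dense as soon as the [E_fin]-part of [A] has finite mass and its
   [E_infty]-part is finite.  Conversely, if the condition in (a) fails there are
   infinitely many disjoint sets of mass at least 1, and a diagonal union of
   these stays at distance at least [sqrt (1/2)] from any given sequence.  For
   (b), a set closer to [{x}] than [mu {x} ^ (1/2)] must contain [x], while a set
   of finite measure contains only countably many points of [E_fin]. *)
Require Import Defs.
From mathcomp Require Import all_boot all_order all_algebra.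
From mathcomp Require Import finmap.
From mathcomp Require Import all_classical all_reals all_analysis.
From mathcomp Require Import lra.

Set Implicit Arguments.
Unset Strict Implicit.
Unset Printing Implicit Defensive.

Import Order.TTheory GRing.Theory Num.Theory.

Local Open Scope classical_set_scope.
Local Open Scope ring_scope.
Local Open Scope ereal_scope.

(** * Countability from bounded mass, and a diagonal construction *)

Section MeasurableSingletons.
Context (d : measure_display) (E : measurableType d) (R : realType).
Variable mu : {measure set E -> \bar R}.
Implicit Types A F : set E.

Lemma countable_set1_measurable A : countable A ->
  (forall x, A x -> measurable [set x]) -> measurable A.
Proof.
move=> cA mA.
have -> : A = \bigcup_(x in A) [set x] by rewrite bigcup_imset1 image_id.
rewrite bigcup_set_type; apply: countable_bigcupT_measurable.
  by rewrite (eq_countable (card_setT _)).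
by move=> x; apply: mA; exact: set_mem (valP x).
Qed.

Lemma measure_finite_set F : finite_set F ->
  (forall x, F x -> measurable [set x]) -> mu F = \sum_(x \in F) mu [set x].
Proof.
move=> fF mF; rewrite -measure_fin_bigcup//.
- by rewrite bigcup_imset1 image_id.
- by move=> x y _ _ [z [-> ->]].
Qed.

(** Only finitely many points can have mass above [1 / (n + 1)], since otherwise finitely many of
    them would exceed the bound [M]. The bound is on finite subsets because [A] is not known to be
    measurable. *)
Lemma countable_atoms A (M : R) :
  (forall x, A x -> measurable [set x] /\ 0 < mu [set x]) ->
  (forall F, finite_set F -> F `<=` A -> mu F <= M%:E) -> countable A.
Proof.
move=> Apos AM.
have -> : A = \bigcup_n [set x | A x /\ (n.+1%:R^-1)%:E < mu [set x]].
  apply/seteqP; split => [x Ax|x [n _ []]//].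
  have [_] := Apos _ Ax; case mux : (mu [set x]) => [r| |]// => [r0|_]; last first.
    by exists 0%N => //; split=> //; rewrite mux ltry.
  have /= [n _ /(_ n (leqnn n)) nr] := near_infty_natSinv_lt (PosNum r0).
  by exists n => //; split=> //; rewrite mux lte_fin.
apply: bigcup_countable => // n _; apply: finite_set_countable.
(* More than [M * (n + 1)] points, each of mass above [1 / (n + 1)], have total mass above [M]. *)
apply: contrapT => /(infinite_set_fset (Num.truncn (M * n.+1%:R)).+1)[B BA Bsize].
have BAx : [set` B] `<=` A by move=> x /BA[].
have := AM _ (finite_fset B) BAx; apply/negP; rewrite -ltNge.
rewrite measure_finite_set//; last by move=> x /BAx /Apos[].
rewrite fsbig_finite// set_fsetK.
apply: (@lt_le_trans _ _ (\sum_(x <- B) (n.+1%:R^-1)%:E)); last first.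
  rewrite big_seq [leRHS]big_seq; apply: lee_sum => x xB.
  by apply/ltW; have [] := BA x xB.
rewrite sumEFin lte_fin big_const_seq count_predT iter_addr_0.
rewrite -[X in (_ < X)%R]mulr_natl ltr_pdivlMr//.
by rewrite (lt_le_trans (truncnS_gt _))// ler_nat.
Qed.


(* Cantor's diagonal argument: a union of some of the [F n] that disagrees with
   the element of [DD] numbered [n] on the block [F n]. *)
Lemma diagonal_union (F : nat -> set E) (DD : set (set E)) :
  (forall n, measurable (F n)) -> (forall n, 1 <= mu (F n)) ->
  trivIset setT F -> countable DD -> DD `<=` measurable ->
  exists2 U, measurable U & forall D, DD D -> (2^-1)%:E <= mu (U `+` D).
Proof.
(* A block of mass at least 1 is cut by [D] into two pieces, one of which has mass at least 1/2. *)
have half (a b : \bar R) :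
    0 <= b -> b < (2^-1)%:E -> 1 <= a + b -> (2^-1)%:E <= a.
  case: a b => [a| |] [b| |]//; rewrite ?leey// -EFinD !lte_fin !lee_fin; lra.
move=> mF F1 tF /countable_injP[f finj] mDD.
(* A block enters the union exactly when the set with its number fills less than mass 1/2 of it. *)
pose N := [set n | exists2 D, DD D & f D = n /\ mu (F n `&` D) < (2^-1)%:E].
have mU : measurable (\bigcup_(n in N) F n) by exact: bigcup_measurable.
exists (\bigcup_(n in N) F n) => // D DDD; have mD := mDD _ DDD.
set U := \bigcup_(n in N) F n in mU *; have mUD := measurable_setY mU mD.
have [lt2|ge2] := ltP (mu (F (f D) `&` D)) (2^-1)%:E.
- have FU : F (f D) `\` D `<=` U `+` D.
    by move=> x [Fx Dx]; left; split => //; exists (f D) => //; exists D.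
  apply: (@le_trans _ _ (mu (F (f D) `\` D))); last first.
    by apply: le_measure; rewrite ?inE//; exact: measurableD.
  apply: (half _ (mu (F (f D) `&` D))) => //.
  by have := F1 (f D); rewrite (measureDI mu (mF _) mD).
- have FU : F (f D) `&` D `<=` U `+` D.
    move=> x [Fx Dx]; right; split => // -[n [D' DDD' [fD' lt2]] Fnx].
    (* Disjointness identifies the block and injectivity of [f] identifies the set, so block [f D]
       was left out of [U]. *)
    have nE : n = f D by apply: (tF n (f D)) => //; exists x.
    have D'E : D' = D by apply: finj; rewrite ?inE// fD'.
    by move: lt2; rewrite nE D'E ltNge ge2.
  apply: (le_trans ge2); apply: le_measure; rewrite ?inE//.
  exact: measurableI.
Qed.

End MeasurableSingletons.

(** * Separability expressed with sets instead of classes *)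

Section SeparableClasses.
Context (d : measure_display) (E : measurableType d) (R : realType).
Variables (mu : {measure set E -> \bar R}) (P : set (set E)).

(** Representatives of a dense set of classes form such a family, and conversely. The square root in
    [dmu] only rescales radii: [Num.sqrt e] in one direction, [e ^+ 2] in the other. *)
Lemma separable_mclass_spaceP :
  separable (mclass_space mu P) <->
  exists DD : set (set E), [/\ countable DD, DD `<=` measurable `&` P &
    forall (A : set E) (e : R), measurable A -> P A -> (0 < e)%R ->
      exists2 D, DD D & mu (A `+` D) < e%:E].
Proof.
have sqrte_lt (x : \bar R) (e : R) : 0 <= x -> (0 < e)%R ->
    (sqrte x < (Num.sqrt e)%:E) = (x < e%:E).
  by move=> x0 e0; rewrite !ltNge -[(Num.sqrt e)%:E]/(sqrte e%:E) lee_sqrt.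
split.
- move=> [DD [cDD dDD]].
  have /choice[rep repP] : forall X : mclass_space mu P, exists A : set E,
      [/\ measurable A, P A & mclass mu A = val X].
    by move=> X; have [A [mA PA] AX] := set_mem (valP X); exists A.
  exists (rep @` DD); split.
  + exact: sub_countable (card_image_le _ _) cDD.
  + by move=> _ [X _ <-]; have [] := repP X.
  + move=> A e mA PA e0.
    have AP : mclasses mu P (mclass mu A) by exists A.
    pose X : mclass_space mu P := SigSub (mem_set AP).
    have se0 : (0 < Num.sqrt e)%R by rewrite sqrtr_gt0.
    (* Density speaks of open sets, so the ball is replaced by its interior, which still contains
       its centre. *)
    have [|Y [YX DY]] := dDD _ _ (@open_interior _ (ball X (Num.sqrt e))).
      by exists X; exact: nbhsx_ballx.
    exists (rep Y); first by exists Y.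
    have [mB PB BY] := repP Y.
    have := interior_subset YX; rewrite /ball/= /mclass_ball/= -BY dmuE//.
    by rewrite sqrte_lt.
- move=> [DD [cDD mDD dDD]].
  exists [set X : mclass_space mu P | exists2 D, DD D & mclass mu D = val X].
  split.
  + apply: (sub_countable (@card_ge_preimage _ _ (mclass mu @` DD) val _)).
      by move=> X Y _ _; exact: val_inj.
    exact: sub_countable (card_image_le _ _) cDD.
  + move=> O [X OX] oO.
    have [e/= e0 XO] := (nbhs_ballP _ _).1 (open_nbhs_nbhs (conj oO OX)).
    have [A [mA PA] AX] := set_mem (valP X).
    have e20 : (0 < e ^+ 2)%R by rewrite exprn_gt0.
    have [D DDD AD] := dDD A _ mA PA e20.
    have [mD PD] := mDD _ DDD.
    have DP : mclasses mu P (mclass mu D) by exists D.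
    exists (SigSub (mem_set DP) : mclass_space mu P); split; last by exists D.
    apply: XO; rewrite /ball/= /mclass_ball/= -AX dmuE//.
    by rewrite -[e]ger0_norm ?ltW// -sqrtr_sqr sqrte_lt.
Qed.

End SeparableClasses.

(** * Points of finite and of infinite mass *)

Section PurelyAtomic.
Context (d : measure_display) (E : measurableType d) (R : realType).
Variable mu : {measure set E -> \bar R}.
Implicit Types A F G T : set E.

Lemma E_fin_countable A : measurable A -> mu A < +oo ->
  countable (A `&` E_fin mu).
Proof.
move=> mA Aoo; apply: (@countable_atoms _ _ _ mu _ (fine (mu A))).
  by move=> x [_ [mx /andP[x0 _]]].
move=> F fF FA; rewrite fineK; last by rewrite ge0_fin_numE.
apply: le_measure; rewrite ?inE//; last by move=> x /FA[].
apply: countable_set1_measurable; first exact: finite_set_countable.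
by move=> x /FA[_ []].
Qed.

Definition atoms : set E := E_fin mu `|` E_infty mu.

Lemma setI_E_fin_measurable A : countable (E_fin mu) ->
  measurable (A `&` E_fin mu).
Proof.
move=> cE; apply: countable_set1_measurable; last by move=> x [_ []].
by apply: sub_countable cE; apply: subset_card_le => x [].
Qed.

Lemma atoms_pos x : atoms x -> measurable [set x] /\ 0 < mu [set x].
Proof. by move=> [[mx /andP[]]|[mx xoo]]; split => //; rewrite xoo ltry. Qed.

Lemma sub_atoms_measurable F : finite_set F -> F `<=` atoms -> measurable F.
Proof.
move=> fF Fat; apply: countable_set1_measurable; first exact: finite_set_countable.
by move=> x /Fat /atoms_pos[].
Qed.

Lemma measure_sub_E_fin F : finite_set F -> F `<=` E_fin mu ->
  mu F <= \esum_(x in E_fin mu) mu [set x].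
Proof.
move=> fF FE; apply: esum_ge; exists F => //.
by rewrite -measure_finite_set// => x /FE[].
Qed.

Lemma measure_sub_E_fin_lty F : finite_set F -> F `<=` E_fin mu -> mu F < +oo.
Proof.
move=> fF FE; rewrite measure_finite_set//; last by move=> x /FE[].
rewrite fsbig_finite//= big_seq lte_sum_pinfty// => x.
by rewrite in_fset_set// inE => /FE[_ /andP[]].
Qed.

(* If no finite set of atoms exhausted [E_fin] up to mass 1 and all of
   [E_infty], successive finite extensions would yield infinitely many disjoint
   blocks of mass at least 1. *)
Lemma exhausting_or_blocks :
  (\esum_(x in E_fin mu) mu [set x] < +oo /\ finite_set (E_infty mu)) \/
  exists F : nat -> set E, [/\ forall n, measurable (F n),
    forall n, 1 <= mu (F n) & trivIset setT F].
Proof.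
pose ok G := finite_set G /\ G `<=` atoms.
have [[G [fG Gat] Gmax]|ext] := pselect (exists2 G, ok G &
    forall F, ok F -> F `&` G = set0 -> mu F < 1); [left|right].
- split; last first.
    (* A point of [E_infty mu] outside [G] would be a disjoint finite set of infinite mass, against
       [Gmax]. *)
    apply: sub_finite_set fG => x xoo; apply: contrapT => Gx.
    have : mu [set x] < 1.
      apply: Gmax; first by split => [//|_ ->]; right.
      by apply/seteqP; split => // _ [->].
    by case: xoo => _ ->.
  have fGE : finite_set (G `&` E_fin mu) by apply: finite_setIl.
  have mGE : measurable (G `&` E_fin mu).
    by apply: sub_atoms_measurable => // x [_]; left.
  (* A finite subset of [E_fin mu] splits into a part inside [G] and a part outside, the latter of
     mass below 1. *)
  apply: (@le_lt_trans _ _ (mu (G `&` E_fin mu) + 1)).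
    apply: ge_ereal_sup => _ [X [fX XE] <-].
    rewrite -measure_finite_set//; last by move=> x /XE[].
    have okD : ok (X `\` G) by split; [exact: finite_setD | move=> x [/XE]; left].
    have mD := sub_atoms_measurable okD.1 okD.2.
    apply: (@le_trans _ _ (mu ((G `&` E_fin mu) `|` (X `\` G)))).
      apply: le_measure; rewrite ?inE//.
      + by apply: sub_atoms_measurable => // x /XE; left.
      + exact: measurableU.
      + by move=> x Xx; have [Gx|Gx] := pselect (G x);
          [left; split => //; exact: XE | right].
    apply: (le_trans (measureU2 _ _ _)) => //; rewrite leeD2l// ltW// Gmax//.
    by apply/seteqP; split => // x [[]].
  by rewrite lte_add_pinfty// ?ltry// measure_sub_E_fin_lty// => x [].
- have /choice[step stepP] : forall G, exists G', ok G ->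
      [/\ ok G', G `<=` G' & 1 <= mu (G' `\` G)].
    move=> G; apply: contrapT => noG'; apply: ext.
    have [okG|nokG] := pselect (ok G); last by case: noG'; exists G.
    exists G => // F okF FG; rewrite ltNge; apply/negP => F1; apply: noG'.
    exists (G `|` F) => _; split.
    + split; first by rewrite finite_setU; split; [exact: okG.1 | exact: okF.1].
      by move=> x [/okG.2|/okF.2].
    + by move=> x; left.
    + by rewrite setDUl setDv set0U setDidl.
  pose G n := iter n step set0.
  have okG n : ok (G n) by elim: n => [|n /stepP[]//]; split.
  have mG n : measurable (G n).
    by apply: sub_atoms_measurable; [exact: (okG n).1 | exact: (okG n).2].
  have GS n : G n `<=` G n.+1 by have [] := stepP _ (okG n).
  have G_homo : {homo G : m n / (m <= n)%N >-> m `<=` n}.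
    by apply: homo_leq => //; [move=> A x | move=> B A C AB BC x /AB /BC].
  exists (fun n => G n.+1 `\` G n); split.
  + by move=> n; exact: measurableD.
  + by move=> n; have [] := stepP _ (okG n).
  + apply: ltn_trivIset => n m mn; apply/seteqP; split => // x [[Gm _] [_]].
    by apply; apply: G_homo mn _ Gm.
Qed.

(** * Inner approximation for a purely atomic measure *)

Variable CC : set (set E).
Hypothesis mu_atomic : purely_atomic_with mu CC.
Hypothesis CC_singletons : forall C, CC C -> exists x : E, C = [set x].

Lemma CC_atoms C : CC C -> exists2 x, atoms x & C = [set x].
Proof.
move=> CCC; have [x Cx] := CC_singletons CCC; exists x => //.
have [[mC C0 _]|[y yoo yC]] := mu_atomic.1 _ CCC; [left|right].
- by rewrite Cx in mC C0.
- by have : [set x] x by []; rewrite -Cx -yC => ->.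
Qed.

(** [mu A] is a supremum of finite sums over [CC]. A singleton counted there lies in [A], because
    otherwise its positive mass would equal that of the empty set. *)
Lemma atoms_inner A (t : \bar R) : measurable A -> t < mu A ->
  exists F, [/\ finite_set F, F `<=` A `&` atoms & t < mu F].
Proof.
move=> mA; rewrite (mu_atomic.2 _ mA) => /ereal_sup_gt[_ [X [fX XC] <-] tX].
have Xat C : X C -> exists2 x, (A `&` atoms) x & C = [set x].
  move=> /XC[CCC /= AC]; have [x xat Cx] := CC_atoms CCC; exists x => //.
  split => //; apply: contrapT => Ax.
  have [_] := atoms_pos xat; rewrite -Cx -AC (_ : A `&` C = set0) ?measure0 ?ltxx//.
  by apply/seteqP; split => // y []; rewrite Cx => /[swap] ->.
exists (\bigcup_(C in X) C); split.
- apply: bigcup_finite => // C /Xat[x _ ->]; exact: finite_set1.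
- by move=> x [C /Xat[y Ay ->] ->].
- rewrite measure_fin_bigcup//.
  + move=> C C' /Xat[x _ ->] /Xat[y _ ->] [z [/= <- ->]] //.
  + by move=> C /Xat[x [_ /atoms_pos[mx _]] ->].
Qed.

Lemma atoms_null A : measurable A -> A `&` atoms = set0 -> mu A = 0.
Proof.
move=> mA A0; apply/eqP; rewrite eq_le measure_ge0 andbT leNgt; apply/negP.
move=> /(atoms_inner mA)[F []]; rewrite A0 subset0 => _ ->.
by rewrite measure0 ltxx.
Qed.

(** [A] splits into its [E_fin] part, exhausted up to [e] by [atoms_inner], its finite [E_infty]
    part, taken whole, and a remainder without atoms, which is null. *)
Lemma atoms_approx A (e : R) : countable (E_fin mu) -> measurable A ->
  mu (A `&` E_fin mu) < +oo -> finite_set (A `&` E_infty mu) -> (0 < e)%R ->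
  exists F, [/\ finite_set F, F `<=` A `&` atoms & mu (A `\` F) < e%:E].
Proof.
move=> cE mA Aoo fA e0; set A1 := A `&` E_fin mu in Aoo *.
have mA1 : measurable A1 by exact: setI_E_fin_measurable.
have finA1 : mu A1 \is a fin_num by rewrite ge0_fin_numE.
have [|F0 [fF0 F0A tF0]] := @atoms_inner A1 (mu A1 - e%:E) mA1.
  by rewrite gte_subl// lte_fin.
have mF0 : measurable F0 by apply: sub_atoms_measurable => // x /F0A[].
have mAoo : measurable (A `&` E_infty mu).
  by apply: sub_atoms_measurable => // x [_]; right.
exists (F0 `|` (A `&` E_infty mu)); split.
- by rewrite finite_setU.
- by move=> x [/F0A[[]]|[]] //; split => //; right.
have mrest : measurable (A `\` (A1 `|` (A `&` E_infty mu))).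
  by apply: measurableD => //; exact: measurableU.
have mA1F0 : measurable (A1 `\` F0) by exact: measurableD.
apply: (@le_lt_trans _ _ (mu ((A1 `\` F0) `|`
    (A `\` (A1 `|` (A `&` E_infty mu)))))).
  apply: le_measure; rewrite ?inE//.
  - by apply: measurableD => //; exact: measurableU.
  - exact: measurableU.
  - by move=> x /= [Ax]; have [] := pselect (A1 x); tauto.
apply: (le_lt_trans (measureU2 _ _ _)) => //.
rewrite [X in _ + X]atoms_null//; last first.
  by apply/seteqP; split => // x [[Ax nA] xat]; apply: nA; case: xat; [left|right].
have F0A1 : F0 `<=` A1 by move=> x /F0A[].
rewrite adde0 measureD// (setIidr F0A1).
have finF0 : mu F0 \is a fin_num.
  by rewrite ge0_fin_numE// (le_lt_trans _ Aoo)// le_measure ?inE.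
by rewrite lteBlDr// addeC -lteBlDr.
Qed.

(** Serves both sufficiency proofs, with the finite subsets of [T] as dense family: [T] is [atoms]
    for [tildeE] and [E_fin mu] for [tildeE_fin]. *)
Lemma separable_mclass_space (P : set (set E)) T :
  countable (E_fin mu) -> countable T -> T `<=` atoms ->
  (forall F, finite_set F -> F `<=` T -> P F) ->
  (forall A, measurable A -> P A -> [/\ A `&` atoms `<=` T,
    mu (A `&` E_fin mu) < +oo & finite_set (A `&` E_infty mu)]) ->
  separable (mclass_space mu P).
Proof.
move=> cE cT Tat PT PA; apply/separable_mclass_spaceP.
exists [set F | F `<=` T /\ finite_set F]; split.
- exact: countable_finite_subset.
- move=> F [FT fF]; split; last exact: PT.
  by apply: sub_atoms_measurable => // x /FT /Tat.
- move=> A e mA /(PA _ mA)[AT Aoo fA] e0.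
  have [F [fF FA Fe]] := atoms_approx cE mA Aoo fA e0.
  exists F; first by split => // x /FA /AT.
  (* The approximation is from inside, so the symmetric difference is just the part of [A] that is
     missed. *)
  rewrite /setY (_ : F `\` A = set0) ?setU0//.
  by apply/seteqP; split => // x [/FA[]].
Qed.

(** * The two equivalences *)

Lemma separable_tildeE : separable (tildeE mu) <->
  \esum_(x in E_fin mu) mu [set x] < +oo /\ finite_set (E_infty mu).
Proof.
split.
- move=> /separable_mclass_spaceP[DD [cDD mDD dDD]].
  have [//|[F [mF F1 tF]]] := exhausting_or_blocks.
  have mDD' : DD `<=` measurable by move=> D /mDD[].
  have [U mU UD] := diagonal_union mF F1 tF cDD mDD'.
  have [//||D /UD UD2 UD1] := dDD U (2^-1)%R mU; first by rewrite invr_gt0.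
  by move: UD1; rewrite ltNge UD2.
- move=> [sumE fE].
  have sfin : \esum_(x in E_fin mu) mu [set x] \is a fin_num.
    by rewrite ge0_fin_numE// esum_ge0.
  have cE : countable (E_fin mu).
    apply: (@countable_atoms _ _ _ mu _ (fine (\esum_(x in E_fin mu) mu [set x]))).
      by move=> x xE; apply: atoms_pos; left.
    by move=> F fF FE; rewrite fineK//; exact: measure_sub_E_fin.
  apply: (@separable_mclass_space _ atoms) => //.
    by rewrite /atoms -bigcup2E; apply: bigcup_countable => // -[|[|i]] _ //=;
      exact: finite_set_countable.
  move=> A mA _; split; [by move=> x []| | exact: finite_setIr].
  (* If the [E_fin] part of [A] had mass above the total sum, so would one of its finite subsets,
     which is impossible. *)
  apply: le_lt_trans sumE; rewrite leNgt; apply/negP.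
  have mA1 := setI_E_fin_measurable A cE.
  move=> /(atoms_inner mA1)[F [fF FA]]; apply/negP; rewrite -leNgt.
  by apply: measure_sub_E_fin => // x /FA[[]].
Qed.

Lemma separable_tildeE_fin :
  separable (tildeE_fin mu) <-> countable (E_fin mu).
Proof.
split.
- move=> /separable_mclass_spaceP[DD [cDD mDD dDD]].
  apply: (@sub_countable _ _ _ (\bigcup_(D in DD) (D `&` E_fin mu))).
    apply: subset_card_le => x xE; have [mx /andP[x0 xoo]] := xE.
    have finx : mu [set x] \is a fin_num by rewrite ge0_fin_numE.
    (* With the mass of the point as tolerance, [D] must contain [x]: otherwise all of that mass
       lies in the symmetric difference. *)
    have [//||D DDD xD] := dDD [set x] (fine (mu [set x])) mx.
      by rewrite fine_gt0// x0.
    exists D => //; split => //; apply: contrapT => Dx.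
    have [mD _] := mDD _ DDD.
    move: xD; rewrite fineK// ltNge => /negP; apply.
    apply: le_measure; rewrite ?inE//; first exact: measurable_setY.
    by move=> _ ->; left.
  by apply: bigcup_countable => // D /mDD[mD Doo]; exact: E_fin_countable.
- move=> cE; apply: (@separable_mclass_space _ (E_fin mu)) => //.
  + by move=> x; left.
  + by move=> F fF FE; exact: measure_sub_E_fin_lty.
  + move=> A mA /= Aoo.
    have A0 x : A x -> ~ E_infty mu x.
      move=> Ax [mx xoo]; move: Aoo; apply/negP; rewrite -leNgt -xoo.
      by apply: le_measure; rewrite ?inE// => _ ->.
    split.
    * by move=> x [Ax [//|/(A0 _ Ax)]].
    * apply: le_lt_trans Aoo; apply: le_measure; rewrite ?inE//.
      exact: setI_E_fin_measurable.
    * by rewrite (_ : _ `&` _ = set0)//; apply/seteqP; split => // x [/A0].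
Qed.

End PurelyAtomic.

Theorem theorem3p8 (R : realType) (d : measure_display) (E : measurableType d)
    (mu : {measure set E -> \bar R}) (CC : set (set E))
    (mu_atomic : purely_atomic_with mu CC)
    (CC_singletons : forall C, CC C -> exists x : E, C = [set x]) :
  (separable (tildeE mu) <->
     \esum_(x in E_fin mu) mu [set x] < +oo /\ finite_set (E_infty mu)) /\
  (separable (tildeE_fin mu) <-> countable (E_fin mu)).
Proof.
split; first exact: separable_tildeE mu_atomic CC_singletons.
exact: separable_tildeE_fin mu_atomic CC_singletons.
Qed.
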